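(* Let $d\ge2$ and consider Bernoulli parking with parameter $\alpha$ on the infinite $d$-ary tree $\mathbb T_d$. Let $X$ be the total number of cars that arrive to the root and let $\alpha_c(d)$ be the critical value for Bernoulli parking on $\mathbb T_d$. If $\alpha\le\alpha_c(d)$, then $P(X=0)>0$.
   Context: Parking process: on a tree with root $\rho$, each vertex has one parking spot. Initially (time $0$) $\eta_v$ cars arrive to each vertex $v$. Cars move towards the root in discrete time, one edge per time step. When a car arrives at an available spot it parks there and the spot becomes unavailable; if several cars arrive at the same available spot simultaneously, one chosen uniformly at random parks there and the others continue towards the root. (This applies also to the cars arriving initially at a vertex.) $X\in\{0,1,\dots\}\cup\{\infty\}$ is the total number of cars that ever arrive to $\rho$, including the $\eta_\rho$ cars initially there. $\mathbb T_d$ is the infinite rooted tree in which each vertex has $d$ children. Bernoulli parking with parameter $\alpha\in[0,2]$: the $\eta_v$ are i.i.d., equal to $2$ with probability $\alpha/2$ and $0$ otherwise (so $E\eta_v=\alpha$). On $\mathbb T_d$ one has $X=\eta_\rho+\sum_{i=1}^d (X^{(i)}-1)^+$ with $X^{(i)}$ i.i.d. copies of $X$ independent of $\eta_\rho$ and $x^+=\max(0,x)$. $\alpha_c(d)\in(0,1)$ is the number such that, for Bernoulli parking on $\mathbb T_d$, $EX<\infty$ for $\alpha<\alpha_c(d)$ and $X=\infty$ almost surely for $\alpha>\alpha_c(d)$ (its existence is a theorem of Goldschmidt and Przykucki). *)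

(* Defs.v *)
From HB Require Import structures.
From mathcomp Require Export all_boot all_order all_algebra.
From mathcomp Require Export all_classical all_reals all_analysis.

Set Implicit Arguments.
Unset Strict Implicit.
Unset Printing Implicit Defensive.

Import Order.TTheory GRing.Theory Num.Theory.

Local Open Scope classical_set_scope.
Local Open Scope ring_scope.

(* Ulam-Harris words: the root is [::], and the i-th child of v is rcons v i. *)
Definition vertex (d : nat) : choiceType := seq 'I_d.

Definition root (d : nat) : vertex d := [::].
Arguments root d : clear implicits.

Definition child (d : nat) (v : vertex d) (i : 'I_d) : vertex d := rcons v i.

(* Of n cars that arrive together, exactly one parks if n > 0 and the spot is
   available, and the others drive on. Which one parks is decided at random in
   the process, but the numbers of cars do not depend on that choice, so only
   numbers are recorded. *)
Definition driving_on (n : nat) (available : bool) : nat :=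
  if available then n.-1 else n.

(* parking_state eta t v = (number of cars arriving to v at time t,
                            whether the spot of v is available just before
                            these cars try to park). *)
Fixpoint parking_state (d : nat) (eta : vertex d -> nat) (t : nat)
    : vertex d -> nat * bool :=
  if t is s.+1 then
    fun v =>
      let arriving :=
        (\sum_(i < d) let: (n, b) := parking_state eta s (child v i) in
                      driving_on n b)%N in
      let: (n, b) := parking_state eta s v in
      (arriving, b && (n == 0%N))
  else fun v => (eta v, true).

Definition arrivals (d : nat) (eta : vertex d -> nat) (t : nat) (v : vertex d)
    : nat := (parking_state eta t v).1.

(* A car moves at every step until it parks, so it arrives to the root at no
   more than one time, and the sum over all times counts each car once. *)
Definition total_arrivals (R : realType) (d : nat) (eta : vertex d -> nat)
    : \bar R := (\sum_(0 <= t <oo) (arrivals eta t (root d))%:R%:E)%E.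

Definition mutually_independent (disp disp' : measure_display)
    (T : measurableType disp) (T' : measurableType disp') (R : realType)
    (P : probability T R) (I : choiceType) (X : I -> {RV P >-> T'}) : Prop :=
  forall (s : seq I) (A : I -> set T'),
    uniq s -> (forall i, measurable (A i)) ->
    P (\bigcap_(i in [set` s]) (X i @^-1` A i)) =
    (\prod_(i <- s) P (X i @^-1` A i))%E.

(* The intended range of alpha is [0, 2]. *)
Definition bernoulli_parking (disp : measure_display)
    (T : measurableType disp) (R : realType) (P : probability T R)
    (d : nat) (alpha : R) (eta : vertex d -> {RV P >-> nat}) : Prop :=
  [/\ mutually_independent eta,
      forall v, P (eta v @^-1` [set 2%N]) = (alpha / 2)%:E &
      forall v, P (eta v @^-1` [set 0%N]) = (1 - alpha / 2)%:E].

Definition cars_at_root (disp : measure_display)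
    (T : measurableType disp) (R : realType) (P : probability T R)
    (d : nat) (eta : vertex d -> {RV P >-> nat}) (w : T) : \bar R :=
  total_arrivals R (fun v => eta v w).

(* alpha_c is the critical value on the d-ary tree. The law of X is determined
   by d and alpha, so the choice of the probability space is immaterial, and at
   most one number has this property. *)
Definition is_critical_value (R : realType) (d : nat) (alpha_c : R) : Prop :=
  0 < alpha_c < 1 /\
  forall alpha : R, 0 <= alpha <= 2 ->
  forall (disp : measure_display) (T : measurableType disp)
         (P : probability T R) (eta : vertex d -> {RV P >-> nat}),
    bernoulli_parking alpha eta ->
    (alpha < alpha_c -> (\int[P]_w cars_at_root eta w < +oo)%E) /\
    (alpha_c < alpha -> {ae P, forall w, cars_at_root eta w = +oo%E}).

(* Main.v *)
(* Let Y_n count the cars that reach the root within n steps, mu_n its mean,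
   and p = alpha/2. Since Y_(n+1) = eta + sum_i (Y_n^(i) - 1)^+, one has
   mu_(n+1) >= alpha + d (mu_n - 1), so that for alpha < 1 and d >= 2 the excess
   of mu_n over 2 - alpha, once positive, doubles at every step; hence
   mu_n <= 2 - alpha for all n whenever the mean of X is finite. As mu_n is a
   polynomial in alpha, this bound passes to the limit alpha = alpha_c. Then
   2 P(Y_n >= 2) <= mu_n gives P(Y_n <= 1) >= p, and therefore
   P(Y_(n+1) = 0) = (1 - p) P(Y_n <= 1)^d >= (1 - p) p^d, uniformly in n.
   The subcritical processes used in the limit are obtained on the given
   probability space by thinning eta. *)
From mathcomp Require Import ring lra measurable_realfun.
Require Import Defs.
Import Order.TTheory GRing.Theory Num.Theory.
Import numFieldNormedType.Exports.
Local Open Scope classical_set_scope.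
Local Open Scope ring_scope.
Set Implicit Arguments.
Unset Strict Implicit.
Unset Printing Implicit Defensive.

(** * Cars that reach a vertex in n steps *)

(** The cumulative count at [v] up to time n. A child that some car has reached by time m has kept
    exactly one of its cars, so the availability flags drop out of this recursion. *)
Fixpoint arrived (d : nat) (eta : vertex d -> nat) (n : nat) (v : vertex d)
    : nat :=
  if n is m.+1 then
    (eta v + \sum_(i < d) (arrived eta m (child v i)).-1)%N
  else eta v.

Lemma parking_stateS (d : nat) (eta : vertex d -> nat) t v :
  parking_state eta t.+1 v =
  ((\sum_(i < d) driving_on (arrivals eta t (child v i))
                            (parking_state eta t (child v i)).2)%N,
   (parking_state eta t v).2 && (arrivals eta t v == 0%N)).
Proof.
rewrite /arrivals /=; case: (parking_state eta t v) => n b /=; congr (_, _).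
by apply: eq_bigr => i _; case: (parking_state eta t _).
Qed.

Lemma availableE (d : nat) (eta : vertex d -> nat) t v :
  (parking_state eta t v).2 = (\sum_(s < t) arrivals eta s v == 0)%N.
Proof.
elim: t => [|t IHt]; first by rewrite big_ord0.
by rewrite parking_stateS big_ord_recr addn_eq0 -IHt.
Qed.

(** Only the first nonempty batch finds the spot available and loses a car; every later batch drives
    on in full. *)
Lemma sum_driving_on (d : nat) (eta : vertex d -> nat) t v :
  (\sum_(s < t) driving_on (arrivals eta s v) (parking_state eta s v).2)%N =
  (\sum_(s < t) arrivals eta s v)%N.-1.
Proof.
elim: t => [|t IHt]; first by rewrite !big_ord0.
rewrite !big_ord_recr /= IHt availableE /driving_on.
by case: (X in (X == 0)%N) => [|m].
Qed.

(** The term of time 0 is [eta v]. In the rest, the sums over times and over children are exchanged,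
    and each child passes on its total minus the parked car. *)
Lemma sum_arrivals (d : nat) (eta : vertex d -> nat) t v :
  (\sum_(s < t.+1) arrivals eta s v)%N = arrived eta t v.
Proof.
elim: t v => [|t IHt] v; first by rewrite big_ord_recl big_ord0 addn0.
rewrite big_ord_recl; congr (_ + _)%N.
under eq_bigr => s _ do rewrite lift0 /arrivals parking_stateS /=.
rewrite exchange_big /=; apply: eq_bigr => i _.
by rewrite sum_driving_on IHt.
Qed.

Lemma arrived_homo (d : nat) (eta : vertex d -> nat) v :
  {homo (fun n => arrived eta n v) : m n / (m <= n)%N}.
Proof.
apply: homo_leq => [n|n m k|n]; [exact: leqnn | exact: leq_trans |].
by rewrite -!sum_arrivals [leqRHS]big_ord_recr leq_addr.
Qed.

Section total.
Context (R : realType) (d : nat) (eta : vertex d -> nat).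

Lemma arrived_le_total n :
  ((arrived eta n (root d))%:R%:E <= total_arrivals R eta)%E.
Proof.
rewrite -sum_arrivals -(big_mkord xpredT (fun s => arrivals eta s (root d))).
rewrite natr_sum -sumEFin /total_arrivals.
by apply: nneseries_lim_ge => i _ _; rewrite lee_fin.
Qed.

(** Expresses the event X = 0 through counts that each depend on finitely many vertices. *)
Lemma total_eq0 :
  total_arrivals R eta = 0%R%:E <-> forall n, arrived eta n (root d) = 0%N.
Proof.
split=> [X0 n|Y0].
  by have := arrived_le_total n; rewrite X0 lee_fin lern0 => /eqP.
apply: eseries0 => t _ _; have := Y0 t; rewrite -sum_arrivals big_ord_recr /=.
by move/eqP; rewrite addn_eq0 => /andP[_ /eqP ->].
Qed.
End total.

(** * Trees of finite height *)

(* The car counts of all vertices in the first n generations below a vertex,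
   a count being 2 or 0. *)
Fixpoint config (d n : nat) : finType :=
  if n is m.+1 then (bool * {ffun 'I_d -> config d m})%type else bool.

Fixpoint cars (d n : nat) : config d n -> nat :=
  match n with
  | 0 => fun b : bool => (2 * b)%N
  | m.+1 => fun c : bool * {ffun 'I_d -> config d m} =>
      (2 * c.1 + \sum_(i < d) (cars (c.2 i)).-1)%N
  end.

(** Defined over any ring: with the indeterminate of a polynomial ring in place of p, the weights
    become polynomials. *)
Definition coin (R : pzRingType) (p : R) (b : bool) : R :=
  if b then p else 1 - p.

Fixpoint weight (R : pzRingType) (p : R) (d n : nat) : config d n -> R :=
  match n with
  | 0 => coin p
  | m.+1 => fun c : bool * {ffun 'I_d -> config d m} =>
      coin p c.1 * \prod_(i < d) weight p (c.2 i)
  end.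

Definition expect (R : pzRingType) (p : R) (d n : nat) (g : nat -> R) : R :=
  \sum_(c : config d n) weight p c * g (cars c).

(** * Recursions and bounds on finite trees *)

Section model.
Context (R : realType) (p : R) (d : nat).

Lemma sum_coin (f : bool -> R) :
  \sum_b coin p b * f b = p * f true + (1 - p) * f false.
Proof. by rewrite big_bool. Qed.

(** The root and its branches are independent, so a product of observables factors. Later sums are
    padded with factors 1 to take this form. *)
Lemma sum_configS n (f : bool -> R) (h : {ffun 'I_d -> config d n} -> R) :
  \sum_(c : config d n.+1) weight p c * (f c.1 * h c.2) =
  (p * f true + (1 - p) * f false) *
  \sum_(x : {ffun 'I_d -> config d n}) (\prod_(i < d) weight p (x i)) * h x.
Proof.
rewrite -sum_coin big_distrlr /= pair_bigA /=.
by apply: eq_bigr => c _; rewrite mulrACA.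
Qed.

Lemma sum_weight n : \sum_(c : config d n) weight p c = 1.
Proof.
elim: n => [|n IHn]; first by rewrite big_bool /= addrC subrK.
under eq_bigr => c _ do rewrite -[weight p c]mulr1 -[X in _ * X]mulr1.
rewrite (sum_configS (fun=> 1) (fun=> 1)) !mulr1 addrC subrK mul1r.
under eq_bigr => c _ do rewrite mulr1.
by rewrite -(bigA_distr_bigA (fun (i : 'I_d) c => weight p c)) /= IHn
  prodr_const expr1n.
Qed.

Lemma sum_branches n (g : config d n -> R) (i : 'I_d) :
  \sum_(x : {ffun 'I_d -> config d n}) (\prod_j weight p (x j)) * g (x i) =
  \sum_(c : config d n) weight p c * g c.
Proof.
(* The observable sits in the i-th factor only; after distributing, every other branch sums to 1. *)
pose F (j : 'I_d) c := weight p c * (if j == i then g c else 1).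
transitivity (\sum_(x : {ffun 'I_d -> config d n}) \prod_j F j (x j)).
  apply: eq_bigr => x _; rewrite big_split /=; congr (_ * _).
  by rewrite -big_mkcond /= big_pred1_eq.
rewrite -(bigA_distr_bigA F) (bigD1 i) //= [X in _ * X]big1 ?mulr1 => [|j ji].
  by apply: eq_bigr => c _; rewrite /F eqxx.
rewrite -[RHS](sum_weight n); apply: eq_bigr => c _.
by rewrite /F (negPf ji) mulr1.
Qed.

(** Linearity of expectation; the truncated predecessor [y.-1] is the positive part of y - 1. *)
Lemma expectS_mean n :
  expect p d n.+1 (fun y => y%:R) =
  2 * p + d%:R * expect p d n (fun y => y.-1%:R).
Proof.
rewrite /expect.
under eq_bigr => c _ do
  rewrite /= natrD mulrDr -[X in _ * X + _]mulr1 -[X in _ + _ * X]mul1r.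
rewrite big_split /=.
rewrite (sum_configS (fun b => (2 * b)%:R) (fun=> 1)).
rewrite (sum_configS (fun=> 1) (fun x => (\sum_(i < d) (cars (x i)).-1)%:R)).
congr (_ + _).
  under eq_bigr => x _ do rewrite mulr1.
  rewrite -(bigA_distr_bigA (fun (i : 'I_d) c => weight p c)) /= sum_weight.
  by rewrite prodr_const expr1n !mulr1 mulr0 addr0 mulrC.
rewrite !mulr1 addrC subrK mul1r.
under [LHS]eq_bigr => x _ do rewrite natr_sum mulr_sumr.
rewrite exchange_big /=.
under eq_bigr => i _ do rewrite (sum_branches (fun c => (cars c).-1%:R)).
by rewrite sumr_const card_ord mulr_natl.
Qed.

(** No car reaches the root within n + 1 steps iff none starts there and each child is reached by at
    most one car within n steps; the d branches are independent. *)
Lemma expectS_zero n :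
  expect p d n.+1 (fun y => (y == 0%N)%:R) =
  (1 - p) * expect p d n (fun y => (y <= 1)%N%:R) ^+ d.
Proof.
rewrite /expect.
have cars0 (c : config d n.+1) : (cars c == 0%N)%:R =
    (~~ c.1)%:R * \prod_(i < d) (cars (c.2 i) <= 1)%N%:R :> R.
  rewrite /= addn_eq0 muln_eq0 eqb0 -mulnb natrM sum_nat_eq0; congr (_ * _).
  rewrite -big_andE (big_morph (fun b : bool => b%:R : R)
    (id1 := 1) (op1 := *%R)) //.
    by apply: eq_bigr => i _; case: (cars _) => [|[]].
  by move=> a b; rewrite -mulnb natrM.
under eq_bigr => c _ do rewrite cars0.
rewrite (sum_configS (fun b => (~~ b)%:R)
          (fun x => \prod_(i < d) (cars (x i) <= 1)%N%:R)).
rewrite mulr0 add0r mulr1; congr (_ * _).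
under eq_bigr => x _ do rewrite -big_split.
rewrite -(bigA_distr_bigA (fun (i : 'I_d) c =>
  weight p c * (cars c <= 1)%N%:R)).
by rewrite prodr_const card_ord.
Qed.

Lemma weight_ge0 n (c : config d n) : 0 <= p <= 1 -> 0 <= weight p c.
Proof.
move=> /andP[p0 p1].
have coin0 b : 0 <= coin p b by case: b; rewrite //= subr_ge0.
elim: n c => [|n IHn] //= c; rewrite mulr_ge0 // prodr_ge0 // => i _;
  exact: IHn.
Qed.

Lemma le_expect n (g h : nat -> R) :
  0 <= p <= 1 -> (forall y, g y <= h y) -> expect p d n g <= expect p d n h.
Proof.
by move=> p01 gh; apply: ler_sum => c _; rewrite ler_wpM2l ?weight_ge0.
Qed.

Lemma expectD n (g h : nat -> R) :
  expect p d n (fun y => g y + h y) = expect p d n g + expect p d n h.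
Proof.
by rewrite /expect -big_split; apply: eq_bigr => c _; rewrite mulrDr.
Qed.

Lemma expectZ n a (g : nat -> R) :
  expect p d n (fun y => a * g y) = a * expect p d n g.
Proof. by rewrite /expect mulr_sumr; apply: eq_bigr => c _; rewrite mulrCA. Qed.

Lemma expect_cst n a : expect p d n (fun=> a) = a.
Proof. by rewrite /expect -mulr_suml sum_weight mul1r. Qed.

Lemma mean_bounded_le M :
  (2 <= d)%N -> 0 <= p -> 2 * p <= 1 ->
  (forall n, expect p d n (fun y => y%:R) <= M) ->
  forall n, expect p d n (fun y => y%:R) <= 2 - 2 * p.
Proof.
move=> d2 p0 p1 muM n; set mu := fun n => expect p d n (fun y => y%:R).
have p01 : 0 <= p <= 1 by rewrite p0 /=; lra.
have d2R : 2 <= d%:R :> R by rewrite ler_nat.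
have mu_step k : 2 * p + d%:R * (mu k - 1) <= mu k.+1.
  rewrite /mu expectS_mean lerD2l ler_wpM2l //.
  rewrite lerBlDr -[X in _ + X](expect_cst k) -expectD le_expect // => y.
  by rewrite natr1 ler_nat; case: y.
rewrite leNgt; apply/negP => mu_n; pose e := mu n - (2 - 2 * p).
have e0 : 0 < e by rewrite subr_gt0.
have grow k : 2 ^+ k * e <= mu (n + k)%N - (2 - 2 * p).
  elim: k => [|k IHk]; first by rewrite mul1r addn0.
  have ek : 0 <= 2 ^+ k * e by rewrite mulr_ge0 ?exprn_ge0 ?ltW.
  (* With x = 2^k e, the mean is at least 2 - 2p + x >= 1, so d may be replaced by 2 in [mu_step],
     and 2p + 2(1 - 2p + x) = (2 - 2p) + 2x. *)
  rewrite addnS exprS -mulrA; have := mu_step (n + k)%N.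
  move: IHk ek; set x := _ ^+ k * e; set y := mu (n + k)%N; nra.
(* As k < 2^k, such a k pushes the excess above M - (2 - 2p), against the bound M. *)
have [k ltk] : exists k, (M - (2 - 2 * p)) / e < k%:R.
  exists (Num.bound `|(M - (2 - 2 * p)) / e|).
  exact: le_lt_trans (ler_norm _) (archi_boundP (normr_ge0 _)).
have := grow k; apply/negP; rewrite -ltNge.
rewrite ltr_pdivrMr // in ltk.
apply: (@le_lt_trans _ _ (M - (2 - 2 * p))).
  by rewrite lerD2r; exact: muM.
apply: (lt_le_trans ltk); rewrite ler_pM2r // -natrX ler_nat.
exact/ltnW/ltn_expl.
Qed.

Lemma zero_lower_bound n :
  0 <= p <= 1 -> expect p d n (fun y => y%:R) <= 2 - 2 * p ->
  (1 - p) * p ^+ d <= expect p d n.+1 (fun y => (y == 0%N)%:R).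
Proof.
move=> p01 mu_le; rewrite expectS_zero; case/andP: (p01) => p0 p1.
rewrite ler_wpM2l ?subr_ge0 //; apply: lerXn2r; rewrite ?nnegrE //.
  by rewrite -(expect_cst n 0) le_expect.
(* Markov's inequality in a form that bounds P(Y <= 1) from below: pointwise, 2 is at most y plus
   twice the indicator of y <= 1. *)
have : 2 <= expect p d n (fun y => y%:R + 2 * (y <= 1)%N%:R).
  rewrite -[X in X <= _](expect_cst n) le_expect // => -[|[|y]] /=.
  - by rewrite add0r mulr1.
  - by rewrite mulr1 lerDr.
  - by rewrite mulr0 addr0 ler_nat.
rewrite expectD expectZ; lra.
Qed.

End model.

(** Serves the case alpha = 0, where (1 - p) p^d vanishes and gives nothing. *)
Lemma expect_zero_at0 (R : realType) (d n : nat) :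
  1 <= expect (0 : R) d n (fun y => (y == 0%N)%:R).
Proof.
elim: n => [|n IHn].
  by rewrite /expect big_bool /= mul0r add0r subr0 mulr1.
rewrite expectS_zero subr0 mul1r exprn_ege1 //; apply: (le_trans IHn).
by apply: le_expect => [|[|y]] //=; rewrite lexx ler01.
Qed.

Lemma expect_continuous (R : realType) (d n : nat) (g : nat -> R) :
  continuous (fun p : R => expect p d n g).
Proof.
(* The same expectation with the indeterminate as parameter; evaluation at p commutes with the sums
   and products. *)
pose q : {poly R} :=
  \sum_(c : config d n) weight ('X : {poly R}) c * (g (cars c))%:P.
suff -> : (fun p : R => expect p d n g) = horner q by exact: continuous_horner.
apply/funext => p; rewrite horner_sum; apply: eq_bigr => c _.
rewrite hornerM hornerC; congr (_ * _).
elim: n c {q} => [[]|n IHn c] /=; first by rewrite hornerX.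
  by rewrite hornerD hornerN hornerX hornerC.
rewrite hornerM horner_prod; congr (_ * _).
  by case: c.1; rewrite /= ?hornerD ?hornerN ?hornerX ?hornerC.
by apply: eq_bigr => i _; exact: IHn.
Qed.

(** * From finite trees to the probability space *)

(** The configuration placed at [v], as a list of vertices with prescribed values, since
    independence is stated for duplicate-free lists of vertices. *)
Fixpoint cells (d n : nat) (v : vertex d)
    : config d n -> seq (vertex d * bool) :=
  match n with
  | 0 => fun b : bool => [:: (v, b)]
  | m.+1 => fun c : bool * {ffun 'I_d -> config d m} =>
      (v, c.1) :: flatten [seq cells (child v i) (c.2 i) | i <- enum 'I_d]
  end.

Lemma cells_prefix (d n : nat) (v u : vertex d) (c : config d n) :
  u \in [seq x.1 | x <- cells v c] -> seq.prefix v u.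
Proof.
elim: n v c => [|n IHn] v c /=.
  by rewrite inE => /eqP ->; exact: seq.prefix_refl.
rewrite inE => /predU1P[-> | ]; first exact: seq.prefix_refl.
rewrite map_flatten => /flatten_mapP[s /mapP[i _ ->] /IHn].
by apply: seq.prefix_trans; rewrite /child -cats1; exact: seq.prefix_prefix.
Qed.

(** A vertex is shorter than its proper descendants, and the subtrees of two children are disjoint
    because the first |v| + 1 letters of a descendant determine the child. *)
Lemma cells_uniq (d n : nat) (v : vertex d) (c : config d n) :
  uniq [seq x.1 | x <- cells v c].
Proof.
elim: n v c => [|n IHn] v c //=; apply/andP; split.
  apply/negP; rewrite map_flatten => /flatten_mapP[s /mapP[i _ ->]].
  by move=> /cells_prefix/seq.size_prefix; rewrite size_rcons ltnn.
rewrite map_flatten -map_comp /=.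
have : uniq (enum 'I_d) by exact: enum_uniq.
elim: (enum 'I_d) => [|i s IHs] //= /andP[i_s /IHs s_uniq].
rewrite cat_uniq IHn s_uniq andbT /=; apply/hasPn => u.
move=> /flatten_mapP[j js /cells_prefix ju]; apply/negP => /cells_prefix iu.
have ij : i = j.
  move: iu ju; rewrite !prefixE !size_rcons => /eqP -> /eqP.
  by move=> /rcons_inj[].
by rewrite ij js in i_s.
Qed.

Lemma prod_cells (R : comPzRingType) (p : R) (d n : nat) (v : vertex d)
    (c : config d n) :
  \prod_(x <- cells v c) coin p x.2 = weight p c.
Proof.
elim: n v c => [|n IHn] v c /=; first by rewrite big_seq1.
rewrite big_cons big_flatten big_map big_enum; congr (_ * _).
by apply: eq_bigr => i _; exact: IHn.
Qed.

Definition matches (d : nat) (eta : vertex d -> nat)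
  (t : seq (vertex d * bool)) : bool :=
  all (fun x : vertex d * bool => eta x.1 == 2 * x.2)%N t.

Lemma matches_arrived (d n : nat) (eta : vertex d -> nat) v
    (c : config d n) :
  matches eta (cells v c) -> arrived eta n v = cars c.
Proof.
elim: n v c => [|n IHn] v c /=; first by rewrite andbT => /eqP.
move=> /andP[/eqP -> m]; congr (_ + _)%N; apply: eq_bigr => i _.
congr _.-1; apply: IHn; apply/allP => x xi; move/allP: m; apply.
by apply/flatten_mapP; exists i; rewrite ?mem_enum.
Qed.

(** Makes the cylinders of distinct configurations disjoint. *)
Lemma matches_inj (d n : nat) (eta : vertex d -> nat) v
    (c c' : config d n) :
  matches eta (cells v c) -> matches eta (cells v c') -> c = c'.
Proof.
elim: n v c c' => [|n IHn] v c c' /=.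
  by rewrite !andbT => /eqP -> ; case: c; case: c'.
move=> /andP[/eqP -> m] /andP[b m']; case: c c' m m' b => [b x] [b' x'] /=.
move=> m m' bb'; congr (_, _); first by case: b b' bb' {m m'} => [] [].
apply/ffunP => i; apply: (IHn (child v i)).
  apply/allP => y yi; move/allP: m; apply.
  by apply/flatten_mapP; exists i; rewrite ?mem_enum.
apply/allP => y yi; move/allP: m'; apply.
by apply/flatten_mapP; exists i; rewrite ?mem_enum.
Qed.

(** * Cylinder events and measurability *)

Section probability.
Context (disp : measure_display) (T : measurableType disp) (R : realType).
Context (P : probability T R) (d : nat).

Definition cylinder (eta : vertex d -> T -> nat) (t : seq (vertex d * bool))
  : set T := [set w | matches (eta ^~ w) t].

Lemma measurable_nat (X : T -> nat) (A : set nat) :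
  measurable_fun setT X -> measurable (X @^-1` A).
Proof. by move=> mX; rewrite -[X in measurable X]setTI; exact: mX. Qed.

Section variables.
Context (eta : vertex d -> {RV P >-> nat}).

Lemma cylinder_cat s t :
  cylinder eta (s ++ t) = cylinder eta s `&` cylinder eta t.
Proof.
by apply/seteqP; split=> w; rewrite /cylinder /matches /= all_cat => /andP.
Qed.

Lemma measurable_cylinder t : measurable (cylinder eta t).
Proof.
elim: t => [|x t IHt]; first by rewrite (_ : cylinder _ _ = setT) //;
  apply/seteqP.
rewrite -cat1s cylinder_cat; apply: measurableI => //.
rewrite (_ : cylinder _ _ = eta x.1 @^-1` [set (2 * x.2)%N]).
  exact: measurable_nat.
by apply/seteqP; split=> w; rewrite /cylinder /= andbT => /eqP.
Qed.

Lemma measurable_arrived n v :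
  measurable_fun setT (fun w => arrived (eta ^~ w) n v).
Proof.
elim: n v => [|n IHn] v /=; first exact: measurable_funPT.
apply: measurable_fun_addn; first exact: measurable_funPT.
under eq_fun do rewrite -big_enum.
elim: (enum _) => [|i s IHs].
  by under eq_fun do rewrite big_nil; exact: measurable_cst.
under eq_fun do rewrite big_cons.
apply: measurable_fun_addn => //.
exact: (measurableT_comp (f := predn) _ (IHn _)).
Qed.

Lemma measurable_arrivals t v :
  measurable_fun setT (fun w => arrivals (eta ^~ w) t v).
Proof.
case: t => [|t]; first exact: (measurable_arrived 0).
(* The arrivals at time t + 1 are an increment of the cumulative counts, whose recursion gives
   measurability directly. *)
rewrite [X in measurable_fun _ X](_ : _ = fun w =>
  arrived (eta ^~ w) t.+1 v - arrived (eta ^~ w) t v)%N.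
  by apply: measurable_fun_subn; exact: measurable_arrived.
by apply/funext => w; rewrite -!sum_arrivals big_ord_recr /= addKn.
Qed.

Lemma measurable_cars_at_root : measurable_fun setT (cars_at_root eta).
Proof.
apply: ge0_emeasurable_sum => [k w _ _|k _]; first by rewrite lee_fin.
exact: (measurableT_comp (f := fun y : nat => y%:R%:E) _
  (measurable_arrivals _ _)).
Qed.
End variables.
End probability.

Lemma map_uniq_inj_in (A B : eqType) (f : A -> B) (s : seq A) :
  uniq (map f s) -> {in s &, injective f}.
Proof.
elim: s => [|z s IHs] //= /andP[z_s /IHs f_inj] x y.
rewrite !inE => /predU1P[->|xs] /predU1P[->|ys] //= fxy.
- by rewrite fxy map_f in z_s.
- by rewrite -fxy map_f in z_s.
- exact: f_inj.
Qed.

Section bernoulli.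
Context (disp : measure_display) (T : measurableType disp) (R : realType).
Context (P : probability T R) (d : nat) (alpha : R).
Context (eta : vertex d -> {RV P >-> nat}).
Hypothesis eta_bernoulli : bernoulli_parking alpha eta.

Lemma probability_cylinder t :
  uniq [seq x.1 | x <- t] ->
  P (cylinder eta t) = (\prod_(x <- t) coin (alpha / 2) x.2)%:E.
Proof.
case: eta_bernoulli => indep P2 P0 t_uniq.
(* Independence asks for one set per vertex, so the prescribed value is read off [t]: 2 where (u,
   true) occurs, else 0. This is consistent because the vertices of [t] are distinct. *)
pose A u := [set (2 * ((u, true) \in t))%N].
have t_true x : x \in t -> ((x.1, true) \in t) = x.2.
  case: x => u [] //= ub; apply/negP => ut.
  by have := map_uniq_inj_in t_uniq ut ub erefl.
have cylE : cylinder eta t =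
    \bigcap_(u in [set` [seq x.1 | x <- t]]) (eta u @^-1` A u).
  apply/seteqP; split=> w.
    move=> /allP m u /= /mapP[x xt ->]; rewrite /A t_true //.
    exact/eqP/m.
  move=> /= m; apply/allP => x xt; have /= := m x.1 (map_f _ xt).
  by rewrite /A /= t_true // => ->.
rewrite cylE indep // big_map -prodEFin big_seq [RHS]big_seq.
apply: eq_bigr => x xt; rewrite /A t_true //.
by case: x.2; rewrite ?muln1 ?muln0 ?P2 ?P0.
Qed.

(* Only an inequality, because no configuration matches on the null set where
   some eta_v is neither 0 nor 2. *)
Lemma expect_le_integral n (g : nat -> R) :
  (forall y, 0 <= g y) ->
  ((expect (alpha / 2) d n g)%:E <=
   \int[P]_w (g (arrived (eta ^~ w) n (root d)))%:E)%E.
Proof.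
move=> g0; pose cyl c := cylinder eta (@cells d n (root d) c).
have mcyl c : measurable (cyl c) by exact: measurable_cylinder.
pose f (c : config d n) w := (g (cars c) * \1_(cyl c) w)%:E.
have -> : (expect (alpha / 2) d n g)%:E = (\sum_c \int[P]_w f c w)%E.
  rewrite /expect -sumEFin; apply: eq_bigr => c _.
  rewrite /f; under eq_integral do rewrite EFinM.
  rewrite ge0_integralZl ?lee_fin //; last first.
    by apply/measurable_EFinP; exact: measurable_indic.
  rewrite integral_indic // setIT mulrC EFinM -(prod_cells _ (root d)).
  by congr (_ * _)%E; apply/esym; exact: probability_cylinder (cells_uniq _ _).
have mf c : measurable_fun setT (f c).
  rewrite /f; apply/measurable_EFinP; apply: measurable_funM => //;
    exact: measurable_indic.
have f0 c w : (0 <= f c w)%E by rewrite lee_fin mulr_ge0.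
rewrite -ge0_integral_sum //.
apply: ge0_le_integral => //.
- by move=> w _; apply: sume_ge0.
- exact: emeasurable_sum.
- have mg : measurable_fun setT (EFin \o g) by [].
  exact: (measurableT_comp mg (measurable_arrived _ _ _)).
move=> w _; rewrite /f sumEFin lee_fin.
(* At most one term is nonzero at [w], where it equals the integrand; off all cylinders the sum is 0
   and g is nonnegative. *)
have [[c wc]|no_c] := pselect (exists c, cyl c w).
  rewrite (bigD1 c) //= big1 ?addr0 => [|c' c'c].
    by rewrite indicE mem_set // mulr1 (matches_arrived wc).
  rewrite indicE memNset ?mulr0 // => wc'.
  by move/eqP: c'c; apply; exact: matches_inj wc' wc.
rewrite big1 // => c _; rewrite indicE memNset ?mulr0 // => wc.
by apply: no_c; exists c.
Qed.
End bernoulli.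

(** * Thinning *)

Section thinning.
Context (disp : measure_display) (T : measurableType disp) (R : realType).
Context (P : probability T R) (d : nat) (o : 'I_d) (k : nat).

(* Each vertex v owns the infinitely many vertices [block_vertex v j], which are
   used as independent coins: v is selected when the coin 0 is heads but the
   coins 0, ..., k are not all heads, which has probability p (1 - p^k) < p. *)
Definition block_vertex (v : vertex d) (j : nat) : vertex d :=
  nseq (pickle (v : seq 'I_d, j)) o.

(** All coins lie on one ray, the words in the single letter [o]; the length of the word encodes the
    pair. *)
Lemma block_vertex_inj v u i j :
  block_vertex v i = block_vertex u j -> v = u /\ i = j.
Proof.
move=> /(congr1 size); rewrite !size_nseq => /(pcan_inj pickleK).
by case.
Qed.

Definition block (v : vertex d) : seq (vertex d * bool) :=
  [seq (block_vertex v j, true) | j <- iota 0 k.+1].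

Definition block_head (v : vertex d) : seq (vertex d * bool) :=
  [:: (block_vertex v 0, true)].

Lemma block_uniq v : uniq [seq x.1 | x <- block v].
Proof.
rewrite -map_comp map_inj_uniq ?iota_uniq // => i j /=.
by move=> /block_vertex_inj[].
Qed.

Lemma block_disjoint v u w :
  w \in [seq x.1 | x <- block v] -> w \in [seq x.1 | x <- block u] -> v = u.
Proof.
rewrite -!map_comp => /mapP[i _ ->] /mapP[j _ /=].
by move=> /block_vertex_inj[].
Qed.

Lemma sub_block_head v : {subset block_head v <= block v}.
Proof. by move=> x; rewrite inE => /eqP ->; rewrite /block /= inE eqxx. Qed.

Lemma probabilityD (A B : set T) : measurable A -> measurable B ->
  P (A `\` B) = (P A - P (A `&` B))%E.
Proof.
move=> mA mB; apply: measureD => //.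
by rewrite (le_lt_trans (probability_le1 _ _)) ?ltry.
Qed.

Lemma probabilityU (A B : set T) : measurable A -> measurable B ->
  A `&` B = set0 -> P (A `|` B) = (P A + P B)%E.
Proof. exact: measureU. Qed.

Section variables.
Context (alpha : R) (eta : vertex d -> {RV P >-> nat}).
Hypothesis eta_bernoulli : bernoulli_parking alpha eta.

Let p := alpha / 2.
Let q := p * (1 - p ^+ k).

Definition selected v : set T :=
  cylinder eta (block_head v) `\` cylinder eta (block v).

Definition thinned v (w : T) : nat := (2 * (w \in selected v))%N.

Lemma measurable_selected v : measurable (selected v).
Proof. by apply: measurableD; exact: measurable_cylinder. Qed.

(** Only the values 2 and 0 occur, so [A] matters only through these two points. *)
Lemma thinned_preimage v (A : set nat) :
  thinned v @^-1` A =
  (if 2%N \in A then selected v else set0) `|`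
  (if 0%N \in A then ~` selected v else set0).
Proof.
apply/seteqP; rewrite /thinned; split=> w /=.
  case: (boolP (w \in _)) => wv Aw.
    by left; rewrite mem_set //; exact: set_mem wv.
  by right; rewrite mem_set //= => /mem_set; exact/negP.
case: ifP => [/set_mem A2|_] [].
- by move=> wv; rewrite mem_set.
- by case: ifP => // /set_mem A0 wv; rewrite memNset.
- by [].
- by case: ifP => // /set_mem A0 wv; rewrite memNset.
Qed.

Lemma measurable_thinned v : measurable_fun setT (thinned v).
Proof.
move=> _ A _; rewrite setTI thinned_preimage.
by apply: measurableU; case: ifP => // _; [|apply: measurableC];
  exact: measurable_selected.
Qed.

Definition thinned_RV v : {RV P >-> nat} :=
  mfun_Sub (mem_set (measurable_thinned v)).

Definition thinned_prob (A : set nat) : R :=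
  (if 2%N \in A then q else 0) + (if 0%N \in A then 1 - q else 0).

(* The cylinder t is what makes the induction on s work: the block of a vertex
   moved out of s is absorbed in t. *)
Lemma probability_thinned_cylinder (s : seq (vertex d))
    (A : vertex d -> set nat) t :
  uniq s -> uniq [seq x.1 | x <- t] ->
  (forall v u, v \in s -> u \in [seq x.1 | x <- block v] ->
    u \notin [seq x.1 | x <- t]) ->
  P (cylinder eta t `&` \big[setI/setT]_(v <- s) (thinned v @^-1` A v)) =
  (\prod_(v <- s) thinned_prob (A v) * \prod_(x <- t) coin p x.2)%:E.
Proof.
elim: s t => [|v s IHs] t.
  move=> _ t_uniq _; rewrite !big_nil mul1r setIT.
  exact: probability_cylinder.
rewrite cons_uniq => /andP[v_s s_uniq] t_uniq v_t.
rewrite !big_cons.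
set F := \big[setI/setT]_(u <- s) _.
have mF : measurable F.
  apply: bigsetI_measurable => u _; apply: measurable_nat.
  exact: measurable_thinned.
pose G := cylinder eta t `&` F.
have mG : measurable G by apply: measurableI => //; exact: measurable_cylinder.
pose Q := \prod_(u <- s) thinned_prob (A u) * \prod_(x <- t) coin p x.2.
have PG : P G = Q%:E.
  by apply: IHs => // u w us; apply: v_t; rewrite inE us orbT.
(* Adding part of the block of v to [t] keeps the induction hypotheses true: [t] avoids this block,
   and blocks of distinct vertices are disjoint. *)
have PGblock b : subseq b (block v) ->
    P (G `&` cylinder eta b) = (Q * \prod_(x <- b) coin p x.2)%:E.
  move=> bv; have bv1 : subseq [seq x.1 | x <- b] [seq x.1 | x <- block v].
    exact: map_subseq.
  rewrite setIC /G setIA -cylinder_cat IHs //.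
  - by rewrite big_cat /= /Q; congr _%:E; ring.
  - rewrite map_cat cat_uniq t_uniq (subseq_uniq bv1 (block_uniq v)) andbT /=.
    apply/hasPn => u ut; apply/negP => /(mem_subseq bv1) uv.
    by have := v_t v u (mem_head v s) uv; rewrite ut.
  - move=> u w us wu; rewrite map_cat mem_cat negb_or (v_t u w) ?inE ?us ?orbT //
    andbT.
    apply/negP => /(mem_subseq bv1) /block_disjoint/(_ wu) vu.
    by rewrite vu us in v_s.
(* The cylinder of the block lies inside that of its head, so the difference has mass Q (p -
   p^(k+1)) = Q q. *)
have Psel : P (G `&` selected v) = (Q * q)%:E.
  rewrite /selected setDE setIA -setDE probabilityD //; last 2 first.
  - by apply: measurableI => //; exact: measurable_cylinder.
  - exact: measurable_cylinder.
  rewrite -(setIA G) (_ : cylinder _ (block_head v) `&` _ =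
    cylinder eta (block v)); last first.
    apply/setIidPr => w /allP m; apply/allP => x xv.
    by apply: m; exact: sub_block_head.
  rewrite !PGblock //; last by rewrite sub1seq sub_block_head // inE.
  rewrite -EFinB -mulrBr; congr (_ * _)%:E.
  rewrite /block /block_head big_seq1 big_map big_const_seq count_predT size_iota.
  by rewrite iter_mulr_1 /= exprS /q mulrBr mulr1.
have Pnsel : P (G `&` ~` selected v) = (Q * (1 - q))%:E.
  rewrite -setDE probabilityD //; last exact: measurable_selected.
  by rewrite PG Psel -EFinB; congr _%:E; ring.
rewrite setIA [X in X `&` F]setIC -setIA -/G setIC thinned_preimage setIUr.
rewrite -mulrA -/Q /thinned_prob.
rewrite probabilityU; last 3 first.
- by apply: measurableI => //; case: ifP => // _; exact: measurable_selected.
- apply: measurableI => //; case: ifP => // _.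
  by apply: measurableC; exact: measurable_selected.
- apply/seteqP; split=> w // [[_ +] [_ +]].
  by case: ifP => //; case: ifP.
rewrite mulrDl EFinD; congr (_ + _)%E.
  by case: ifP => _; rewrite ?Psel ?setI0 ?measure0 ?mul0r // mulrC.
by case: ifP => _; rewrite ?Pnsel ?setI0 ?measure0 ?mul0r // mulrC.
Qed.

Lemma probability_thinned v (A : set nat) :
  P (thinned v @^-1` A) = (thinned_prob A)%:E.
Proof.
have := @probability_thinned_cylinder [:: v] (fun=> A) [::] isT isT.
rewrite !big_seq1 big_nil mulr1 => <- //.
by rewrite (_ : cylinder _ _ = setT) ?setTI //; apply/seteqP.
Qed.

Lemma thinned_bernoulli : bernoulli_parking (2 * q) thinned_RV.
Proof.
split=> [s A s_uniq _|v|v].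
(* The cylinder of the empty list is the whole space. *)
- transitivity (P (cylinder eta [::] `&`
      \big[setI/setT]_(v <- s) (thinned v @^-1` A v))).
    by rewrite -bigcap_seq (_ : cylinder _ _ = setT) ?setTI //; apply/seteqP.
  rewrite probability_thinned_cylinder // big_nil mulr1 -prodEFin.
  by apply: eq_bigr => v _; rewrite -(probability_thinned v).
- transitivity (thinned_prob [set 2%N])%:E; first exact: probability_thinned.
  by rewrite /thinned_prob mem_set // memNset // addr0; congr _%:E; lra.
- transitivity (thinned_prob [set 0%N])%:E; first exact: probability_thinned.
  by rewrite /thinned_prob [X in if X then q else _]memNset // mem_set //
    add0r; congr _%:E; lra.
Qed.

End variables.
End thinning.

(** * Bounds at the critical value *)

Lemma subcritical_mean_le (R : realType) (d : nat) (alpha_c alpha : R)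
    (disp : measure_display) (T : measurableType disp) (P : probability T R)
    (eta : vertex d -> {RV P >-> nat}) n :
  (2 <= d)%N -> is_critical_value d alpha_c -> 0 <= alpha ->
  bernoulli_parking alpha eta -> alpha < alpha_c ->
  expect (alpha / 2) d n (fun y => y%:R) <= 2 - alpha.
Proof.
move=> d2 [/andP[_ ac1] crit] a0 eta_bern a_lt.
have a02 : 0 <= alpha <= 2 by rewrite a0 /=; lra.
have [/(_ a_lt) X_fin _] := crit _ a02 _ _ _ _ eta_bern.
have -> : 2 - alpha = 2 - 2 * (alpha / 2) by lra.
(* The bound M is the mean of X, finite below the critical value; it dominates every mean on a
   finite tree because Y_n <= X. *)
apply: (@mean_bounded_le _ _ _ (fine (\int[P]_w cars_at_root eta w))) => //;
  [lra|lra|].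
move=> m; have X0 w : (0 <= cars_at_root eta w)%E.
  by apply: nneseries_ge0 => t _ _; rewrite lee_fin.
rewrite -lee_fin fineK; last first.
  by rewrite ge0_fin_numE //; apply: integral_ge0.
apply: le_trans (expect_le_integral eta_bern _ _) _ => //.
apply: ge0_le_integral => //.
- have mR : measurable_fun setT (fun y : nat => y%:R%:E : \bar R) by [].
  exact: (measurableT_comp mR (measurable_arrived _ _ _)).
- exact: measurable_cars_at_root.
- by move=> w _; exact: arrived_le_total.
Qed.

(** The thinned processes have parameters 2 q_k < alpha <= alpha_c, so the subcritical bound holds
    for them; it passes to the limit as q_k tends to p. *)
Lemma critical_mean_le (R : realType) (d : nat) (alpha_c alpha : R)
    (disp : measure_display) (T : measurableType disp) (P : probability T R)
    (eta : vertex d -> {RV P >-> nat}) n :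
  (2 <= d)%N -> is_critical_value d alpha_c -> 0 < alpha ->
  bernoulli_parking alpha eta -> alpha <= alpha_c ->
  expect (alpha / 2) d n (fun y => y%:R) <= 2 - alpha.
Proof.
move=> d2 crit a0 eta_bern a_le; have [/andP[_ ac1] _] := crit.
set p := alpha / 2; have p0 : 0 < p by rewrite /p; lra.
have p1 : p < 1 by rewrite /p; lra.
pose q k := p * (1 - p ^+ k).
have q_cvg : q @ \oo --> p.
  suff : p * (1 - p ^+ k) @[k --> \oo] --> p * (1 - 0) by rewrite subr0 mulr1.
  apply: cvgMr; apply: cvgB; first exact: cvg_cst.
  by apply: cvg_expr; rewrite ger0_norm // ltW.
have mean_le k : expect (q k) d n (fun y => y%:R) <= 2 - 2 * q k.
  have o : 'I_d := Ordinal (ltnW d2).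
  have pk0 : 0 < p ^+ k by rewrite exprn_gt0.
  have pk1 : p ^+ k <= 1 by rewrite exprn_ile1 // ltW.
  have q0 : 0 <= q k by rewrite /q mulr_ge0 ?subr_ge0 // ltW.
  have := @subcritical_mean_le _ _ alpha_c (2 * q k) _ _ _
    (thinned_RV o k eta) n d2 crit.
  have -> : 2 * q k / 2 = q k by field.
  apply; [lra | exact: thinned_bernoulli | ].
  have : q k < p by rewrite /q gtr_pMr // gtrBl.
  by move: a_le; rewrite /p; lra.
(* With 2p moved to the left, the right side is constant and a single limit suffices. *)
suff : expect p d n (fun y => y%:R) + 2 * p <= 2 by rewrite /p; lra.
have lhs_cvg : expect (q k) d n (fun y => y%:R) + 2 * q k @[k --> \oo] -->
    expect p d n (fun y => y%:R) + 2 * p.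
  apply: cvgD; last exact: cvgMr.
  exact: (cvg_comp _ _ q_cvg (@expect_continuous _ _ _ _ p)).
apply: (cvgr_to_le lhs_cvg); apply: nearW => k.
by rewrite -lerBrDr.
Qed.

(** Continuity from above: X = 0 is the decreasing intersection of the events Y_(n+1) = 0. *)
Lemma probability_no_cars_ge (R : realType) (d : nat) (alpha eps : R)
    (disp : measure_display) (T : measurableType disp) (P : probability T R)
    (eta : vertex d -> {RV P >-> nat}) :
  bernoulli_parking alpha eta ->
  (forall n, eps <= expect (alpha / 2) d n.+1 (fun y => (y == 0%N)%:R)) ->
  (eps%:E <= P [set w | cars_at_root eta w = 0%R%:E])%E.
Proof.
move=> eta_bern eps_le.
(* Heights start at 1, where the hypothesis applies; height 0 follows by monotonicity of the
   counts. *)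
pose F n := [set w | arrived (eta ^~ w) n.+1 (root d) = 0%N].
have mF n : measurable (F n).
  exact: measurable_nat [set 0%N] (measurable_arrived eta n.+1 (root d)).
have -> : [set w | cars_at_root eta w = 0%R%:E] = \bigcap_n F n.
  apply/seteqP; split=> w /=.
    by move=> /total_eq0 Y0 n _; exact: Y0.
  move=> Y0; apply/total_eq0 => -[|n]; last exact: Y0.
  have /eqP := Y0 0%N I; rewrite -leqn0.
  move=> Y1; apply/eqP; rewrite -leqn0; apply: leq_trans Y1.
  exact: arrived_homo.
have F_decr : nonincreasing_seq F.
  move=> m n mn; apply/subsetPset => w /eqP.
  rewrite -leqn0 => Yn; apply/eqP; rewrite -leqn0; apply: leq_trans Yn.
  exact: (@arrived_homo _ _ _ m.+1 n.+1).
have PF : P \o F @ \oo --> P (\bigcap_n F n).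
  apply: nonincreasing_cvg_mu => //.
    by rewrite (le_lt_trans (probability_le1 _ _)) ?ltry.
  exact: bigcap_measurable.
apply: (cvge_to_ge PF); apply: nearW => n /=.
apply: (le_trans
  (y := (expect (alpha / 2) d n.+1 (fun y => (y == 0%N)%:R))%:E)).
  by rewrite lee_fin.
apply: le_trans (expect_le_integral eta_bern _ _) _ => //.
rewrite -[F n]setIT -integral_indic //.
rewrite le_eqVlt; apply/predU1P; left; apply: eq_integral => w _.
rewrite indicE; congr ((nat_of_bool _)%:R%:E).
by apply/idP/idP => [/eqP Y0|/set_mem Y0]; [exact: mem_set | exact/eqP].
Qed.

Theorem proposition3 (R : realType) (d : nat) (alpha_c alpha : R)
    (disp : measure_display) (T : measurableType disp) (P : probability T R)
    (eta : vertex d -> {RV P >-> nat}) :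
  (2 <= d)%N ->
  is_critical_value d alpha_c ->
  0 <= alpha <= 2 ->
  bernoulli_parking alpha eta ->
  alpha <= alpha_c ->
  (0 < P [set w | cars_at_root eta w = 0%R%:E])%E.
Proof.
move=> d2 crit /andP[a0 _] eta_bern a_le; have [/andP[_ ac1] _] := crit.
(* The approximation from below needs alpha > 0; at alpha = 0 the probability is bounded below by
   1. *)
move: a0; rewrite le_eqVlt => /predU1P[a0|a0].
  apply: (@lt_le_trans _ _ 1%:E); first by rewrite lte_fin.
  apply: (probability_no_cars_ge eta_bern) => n.
  by rewrite -a0 mul0r expect_zero_at0.
set p := alpha / 2; have p0 : 0 < p by rewrite /p; lra.
have p1 : p < 1 by rewrite /p; lra.
apply: (@lt_le_trans _ _ ((1 - p) * p ^+ d)%:E).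
  by rewrite lte_fin mulr_gt0 ?exprn_gt0 ?subr_gt0.
apply: (probability_no_cars_ge eta_bern) => n.
apply: zero_lower_bound; first by rewrite !ltW.
have -> : 2 - 2 * p = 2 - alpha by rewrite /p; lra.
exact: critical_mean_le eta_bern a_le.
Qed.
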